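(* Let $n\ge1$, let $\mathbf r=(r_1,\dots,r_n)$ satisfy $r_i>0$ for all $i$ and $\sum_{i=1}^n r_i=1$, and let $a>\max_i\frac{\log 2}{1+r_i}$. Then for any sequence $\{L_i\}_{i\in\mathbb N}$ of nonsingular diagonal $n\times n$ real matrices and any sequence $\{\mathbf y_i\}_{i\in\mathbb N}$ of vectors in $\mathbb R^n$, the intersection $\bigcap_{i=1}^\infty\big(L_i(\mathbf{Bad}(\mathbf r))+\mathbf y_i\big)$ is $a$-winning for the $\psi$-modified Schmidt game, where $\psi(x,t)=\Phi_t^{(\mathbf r)}(D_0)+x$ with $D_0=[-1/2,1/2]^n$ and $\Phi^{(\mathbf r)}_t=\mathrm{diag}\big(e^{-(1+r_1)t},\dots,e^{-(1+r_n)t}\big)$; hence this intersection is thick.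
   Context: A vector $\mathbf x\in\mathbb R^n$ is $\mathbf r$-badly approximable if there is $c>0$ such that $\max_{1\le i\le n}|qx_i-p_i|^{1/r_i}\ge c/q$ for all $\mathbf p\in\mathbb Z^n$ and $q\in\mathbb N$; $\mathbf{Bad}(\mathbf r)$ is the set of all such vectors. A subset of $\mathbb R^n$ is thick if its intersection with every nonempty open subset of $\mathbb R^n$ has Hausdorff dimension $n$. The game: on $\Omega=\mathbb R^n\times\mathbb R$ write $(x',t')\le(x,t)$ iff $\psi(x',t')\subset\psi(x,t)$. For $a,b>0$, the $(a,b)$-game is played by Alice and Bob: Bob picks $\omega_1=(x_1,t_1)\in\Omega$; then for $k=1,2,\dots$, given $\omega_k=(x_k,t_k)$, Alice picks $x_k'$ with $\omega_k'=(x_k',t_k+a)\le\omega_k$, and Bob picks $x_{k+1}$ with $\omega_{k+1}=(x_{k+1},t_k+a+b)\le\omega_k'$, where $t_{k+1}=t_k+a+b$. A set $S$ is $(a,b)$-winning if Alice has a strategy guaranteeing $\bigcap_k\psi(\omega_k)\subset S$ however Bob plays; it is $a$-winning if it is $(a,b)$-winning for all $b>0$. *)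

(* Defs.v *)
From HB Require Import structures.
From mathcomp Require Export all_boot all_order all_algebra.
From mathcomp Require Export all_classical all_reals all_analysis.

Set Implicit Arguments.
Unset Strict Implicit.
Unset Printing Implicit Defensive.

Import Order.TTheory GRing.Theory Num.Theory.
Export numFieldNormedType.Exports.

Local Open Scope classical_set_scope.
Local Open Scope ring_scope.

(* A big maximum over ['I_n] starts from 0; this is the genuine maximum because
   all the families below are nonnegative (and n >= 1 in the theorem). *)
Definition Bad (R : realType) (n : nat) (r : 'I_n -> R) : set 'cV[R]_n :=
  [set x | exists2 c : R, 0 < c &
     forall (p : 'cV[int]_n) (q : nat), (0 < q)%N ->
       c / q%:R <=
       \big[Num.max/0]_(i < n) (`|q%:R * x i 0 - (p i 0)%:~R| `^ (r i)^-1)].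

Section HausdorffDimension.
Variables (R : realType) (V : normedModType R).
Local Open Scope ereal_scope.

(* The supremum over the empty set is -oo, which only matters for U = set0. *)
Definition diameter (U : set V) : \bar R :=
  ereal_sup [set (`|u.1 - u.2|%R)%:E | u in U `*` U].

(* diam(U)^s with the usual conventions: the empty set has weight 0, and
   0^0 = 1, so that the 0-dimensional measure counts points. *)
Definition hausdorff_weight (s : R) (U : set V) : \bar R :=
  if `[< U = set0 >] then 0 else poweR (diameter U) s.

Definition hausdorff_premeasure (s delta : R) (A : set V) : \bar R :=
  ereal_inf [set \sum_(0 <= k <oo) hausdorff_weight s (U k) |
    U in [set U : nat -> set V | A `<=` \bigcup_k U k /\
                                 forall k, diameter (U k) <= delta%:E]].

Definition hausdorff_measure (s : R) (A : set V) : \bar R :=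
  ereal_sup [set hausdorff_premeasure s delta A |
    delta in [set delta : R | (0 < delta)%R]].

Definition hausdorff_dim (A : set V) : \bar R :=
  ereal_inf [set s%:E | s in [set s : R | (0 <= s)%R /\
                                          hausdorff_measure s A = 0]].

End HausdorffDimension.

(* The metric on ['cV[R]_n] is the one of the sup norm; it is bi-Lipschitz
   equivalent to the Euclidean one, hence gives the same Hausdorff dimension. *)
Definition thick (R : realType) (n : nat) (S : set 'cV[R]_n) : Prop :=
  forall U : set 'cV[R]_n, open U -> U !=set0 ->
    hausdorff_dim (S `&` U) = n%:R%:E.

Section Game.
Variables (R : realType) (n : nat).
Local Notation Omega := ('cV[R]_n * R)%type.
Variable psi : Omega -> set 'cV[R]_n.

Definition game_le (w' w : Omega) : Prop := psi w' `<=` psi w.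

(* A strategy of Alice maps the history [:: omega_1; ...; omega_k] of Bob's
   moves (which, with the strategy, determines the whole position) to x'_k.
   Indices are shifted to start at 0. *)
Section Play.
Variables (a b : R) (sigma : seq Omega -> 'cV[R]_n) (omega : nat -> Omega).

Definition alice_move (k : nat) : Omega :=
  (sigma (mkseq omega k.+1), (omega k).2 + a).

Definition alice_legal (k : nat) : Prop := game_le (alice_move k) (omega k).

Definition bob_legal (k : nat) : Prop :=
  (omega k.+1).2 = (omega k).2 + a + b /\
  game_le (omega k.+1) (alice_move k).

End Play.

(* A winning strategy must in particular always provide a legal move as long as
   Bob has played legally. *)
Definition ab_winning (a b : R) (S : set 'cV[R]_n) : Prop :=
  exists sigma : seq Omega -> 'cV[R]_n, forall omega : nat -> Omega,
    (forall k, (forall j, (j < k)%N -> bob_legal a b sigma omega j) ->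
               alice_legal a sigma omega k) /\
    ((forall k, bob_legal a b sigma omega k) ->
     \bigcap_k psi (omega k) `<=` S).

Definition a_winning (a : R) (S : set 'cV[R]_n) : Prop :=
  forall b : R, 0 < b -> ab_winning a b S.

End Game.

Definition Phi (R : realType) (n : nat) (r : 'I_n -> R) (t : R) : 'M[R]_n :=
  diag_mx (\row_(i < n) expR (- (1 + r i) * t)).

Definition D0 (R : realType) (n : nat) : set 'cV[R]_n :=
  [set z | forall i, - (1 / 2) <= z i 0 <= 1 / 2].

Definition psi_box (R : realType) (n : nat) (r : 'I_n -> R)
    (w : 'cV[R]_n * R) : set 'cV[R]_n :=
  [set Phi r w.2 *m z + w.1 | z in @D0 R n].

(* Main.v *)
Require Import Defs.
From mathcomp Require Import perm ring lra zify.

Set Implicit Arguments.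
Unset Strict Implicit.
Unset Printing Implicit Defensive.

Import Order.TTheory GRing.Theory Num.Theory.

Local Open Scope classical_set_scope.
Local Open Scope ring_scope.

(** A box of the game at time t has volume expR (- (n + 1) t), and rational
    points with denominators at most Q, even after an affine change of
    coordinates, span simplices of volume at least a constant times Q^-(n+1).
    So when Q is a small multiple of expR t, those which come close to the box
    lie on one hyperplane ([simplex_lemma]).  The hypothesis on a says that the
    sides of Alice's box are less than half those of Bob's; hence she can play in
    a corner of Bob's box and leave between her box and any given hyperplane a
    gap proportional to the sides of the box ([corner_avoids_hyperplane],
    [alice_avoids_rational_points]).  The box at time t has exactly the shape of
    the forbidden neighbourhood of a rational point with denominator expR t, so
    doing this at a sequence of moves with bounded gaps puts the outcome in the
    image of Bad ([far_from_rationals_Bad]).  Countably many images are treated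
    together by giving the i-th one the moves whose 2-adic valuation is i
    ([Bad_winning]).

    Thickness holds for every winning set S.  The upper bound on the dimension is
    the covering of space by small cubes ([hausdorff_measure_gt_dim]).  For the
    lower bound, Bob plays, with a large b, against Alice's winning strategy and
    against a countable family of balls with small total s-dimensional weight,
    s < n.  He has about expR ((n + 1) b) disjoint moves inside Alice's box.  He
    watches a potential, the sum over the balls of the weighted proportion of his
    box that the cube of twice the radius fills; averaging over the disjoint moves
    shows that some move multiplies it by at most a factor D
    ([small_potential_child]), and D is negligible compared with the shrinking of
    the boxes when b is large.  The m-th ball is weighted by D^K where K is the
    stage at which boxes have become as small as the ball, so a box that met the
    ball at that stage would make the potential at least D^K, a bound which Bob
    never reaches.  The outcome of the play therefore lies in S and in none of
    the balls ([winning_not_covered]).  This replaces the usual construction of a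
    measure on a Cantor set by a greedy choice. *)

(** * Boxes *)

Definition side (R : realType) (n : nat) (r : 'I_n -> R) (i : 'I_n) (t : R) : R :=
  expR (- (1 + r i) * t).

Lemma side_gt0 (R : realType) (n : nat) (r : 'I_n -> R) i t : 0 < side r i t.
Proof. exact: expR_gt0. Qed.

Lemma sideD (R : realType) (n : nat) (r : 'I_n -> R) i s t :
  side r i (s + t) = side r i s * side r i t.
Proof. by rewrite /side mulrDr expRD. Qed.

Lemma prod_side (R : realType) (n : nat) (r : 'I_n -> R) t :
  \sum_(i < n) r i = 1 -> \prod_i side r i t = expR (- (n.+1%:R * t)).
Proof.
move=> r_sum; rewrite -expR_sum; congr expR.
rewrite -mulr_suml sumrN big_split/= r_sum sumr_const card_ord.
by rewrite -[n.+1]addn1 natrD; ring.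
Qed.

Lemma psi_boxP (R : realType) (n : nat) (r : 'I_n -> R) w v :
  psi_box r w v <-> forall i, `|v i 0 - w.1 i 0| <= side r i w.2 / 2.
Proof.
have PhiE (z : 'cV[R]_n) i : (Phi r w.2 *m z) i 0 = side r i w.2 * z i 0.
  by rewrite /Phi mul_diag_mx !mxE.
split=> [[z zD <-] i|h].
  rewrite mxE PhiE addrK normrM gtr0_norm ?side_gt0//.
  rewrite ler_pM2l ?side_gt0// -[_^-1]div1r ler_norml; exact: zD.
exists (\col_i ((v i 0 - w.1 i 0) / side r i w.2)) => [i|].
  rewrite mxE -ler_norml normrM normfV (gtr0_norm (side_gt0 _ _ _)).
  by rewrite ler_pdivrMr ?side_gt0// mulrC mulrA mulr1 h.
apply/colP => i; rewrite mxE PhiE mxE mulrC divfK ?gt_eqF ?side_gt0//.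
by rewrite subrK.
Qed.

Definition lower (R : realType) (n : nat) (r : 'I_n -> R) (w : 'cV[R]_n * R) j :=
  w.1 j 0 - side r j w.2 / 2.
Definition upper (R : realType) (n : nat) (r : 'I_n -> R) (w : 'cV[R]_n * R) j :=
  w.1 j 0 + side r j w.2 / 2.

Lemma psi_box_itv (R : realType) (n : nat) (r : 'I_n -> R) w v :
  psi_box r w v <-> forall j, lower r w j <= v j 0 <= upper r w j.
Proof.
have iff j : (`|v j 0 - w.1 j 0| <= side r j w.2 / 2) =
    (lower r w j <= v j 0 <= upper r w j).
  by rewrite ler_distl.
split=> [/psi_boxP h j|h]; first by rewrite -iff.
by apply/psi_boxP => j; rewrite iff.
Qed.

Lemma upper_sub_lower (R : realType) (n : nat) (r : 'I_n -> R) w j :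
  upper r w j - lower r w j = side r j w.2.
Proof. by rewrite /upper /lower; lra. Qed.

Lemma lower_le_upper (R : realType) (n : nat) (r : 'I_n -> R) w j :
  lower r w j <= upper r w j.
Proof. by rewrite -subr_ge0 upper_sub_lower ltW// side_gt0. Qed.

Lemma game_le_itv (R : realType) (n : nat) (r : 'I_n -> R) w' w :
  game_le (psi_box r) w' w <->
  forall j, lower r w j <= lower r w' j /\ upper r w' j <= upper r w j.
Proof.
split=> [le j|h v /psi_box_itv vw'].
  have [] : psi_box r w (\col_j lower r w' j) /\ psi_box r w (\col_j upper r w' j).
    by split; apply: le; apply/psi_box_itv => i; rewrite mxE lexx lower_le_upper.
  move=> /psi_box_itv/(_ j) + /psi_box_itv/(_ j).
  by rewrite !mxE => /andP[-> _] /andP[_ ->].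
apply/psi_box_itv => j; have [l u] := h j; have /andP[lv vu] := vw' j.
by rewrite (le_trans l)// (le_trans _ u).
Qed.

(** The coordinatewise suprema of the lower endpoints form a common point. *)
Lemma nested_boxes_meet (R : realType) (n : nat) (r : 'I_n -> R)
    (omega : nat -> 'cV[R]_n * R) :
  (forall k, game_le (psi_box r) (omega k.+1) (omega k)) ->
  exists v, forall k, psi_box r (omega k) v.
Proof.
move=> nested.
have mono j k m : lower r (omega k) j <= lower r (omega (m + k)%N) j /\
                  upper r (omega (m + k)%N) j <= upper r (omega k) j.
  elim: m => [|m [IHl IHu]]; first by rewrite add0n.
  have /game_le_itv/(_ j)[l u] := nested (m + k)%N.
  by rewrite addSn (le_trans IHl)// (le_trans u).
have lu j k m : lower r (omega k) j <= upper r (omega m) j.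
  have [[l _] [_ u]] := (mono j k m, mono j m k).
  by rewrite (le_trans l)// (le_trans (lower_le_upper _ _ _))// addnC.
exists (\col_j sup (range (fun k => lower r (omega k) j))) => k.
apply/psi_box_itv => j; rewrite mxE; apply/andP; split.
  apply: ub_le_sup; last by exists k.
  by exists (upper r (omega 0%N) j) => _ [m _ <-].
by apply: ge_sup; [exists (lower r (omega 0%N) j), 0%N|move=> _ [m _ <-]].
Qed.

(** * The simplex lemma *)

(** Greedy choice of independent vectors of S: the process stops before it
    yields m of them, since these would form a matrix with nonzero determinant,
    and S then lies in a proper subspace. *)
Lemma common_annihilator (F : fieldType) (m : nat) (S : set 'rV[F]_m) :
  (forall M : 'M[F]_m, (forall i, S (row i M)) -> \det M = 0) ->
  exists2 A : 'cV[F]_m, A != 0 & forall s, S s -> s *m A = 0.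
Proof.
move=> detS; apply: contrapT => noA.
suff free k : (k <= m)%N ->
    exists M : 'M[F]_(k, m), (forall i, S (row i M)) /\ row_free M.
  have [M [SM]] := free m (leqnn m).
  by rewrite row_free_unit unitmxE (detS _ SM) unitr0.
elim: k => [_|k IH km].
  exists 0; split; first by case.
  by rewrite /row_free mxrank0.
have [M [SM Mfree]] := IH (ltnW km).
have [[s Ss sM]|allM] := pselect (exists2 s, S s & ~~ (s <= M)%MS).
  exists (col_mx s M : 'M[F]_(1 + k, m)); split=> [i|].
    have [j ->|j ->] := @split_ordP 1 k i.
      have := Ss; rewrite -[s in S s](_ : row j s = s); first by rewrite -(rowKu j s M).
      by apply/rowP => ?; rewrite mxE ord1.
    by have := SM j; rewrite -(rowKd j s M).
  suff lt : (k < \rank (col_mx s M))%N by rewrite /row_free eqn_leq rank_leq_row.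
  rewrite -addsmxE addsmxC -[X in (X < _)%N](eqP Mfree) rank_ltmx// /ltmx.
  by rewrite addsmxSl addsmx_sub negb_and sM orbT.
case: noA.
have cM0 : cokermx M != 0.
  apply/negP => /eqP cM0.
  have : (1%:M <= M)%MS by rewrite submxE cM0 mulmx0.
  move=> /mxrankS; rewrite mxrank1 => /leq_trans/(_ (rank_leq_row M)).
  by rewrite leqNgt km.
have [j cj] : exists j, col j (cokermx M) != 0.
  apply: contrapT => /forallNP c0; case/negP: cM0; apply/eqP/matrixP => i j.
  by have /negP/negPn/eqP/colP/(_ i) := c0 j; rewrite !mxE.
exists (col j (cokermx M)) => // s Ss.
rewrite colE mulmxA; suff -> : s *m cokermx M = 0 by rewrite mul0mx.
by apply/eqP; rewrite -submxE; apply: contrapT => /negP sM; apply: allM; exists s.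
Qed.

Lemma norm_det_le (R : realType) (m : nat) (M : 'M[R]_m) (B : 'I_m -> R) :
  (forall i j, `|M i j| <= B j) -> `|\det M| <= (m`!)%:R * \prod_j B j.
Proof.
move=> MB; apply: le_trans (ler_norm_sum _ _ _) _.
rewrite mulr_natl -card_Sn -sumr_const.
apply: ler_sum => s _; rewrite normrM normrX normrN1 expr1n mul1r.
rewrite [leRHS](reindex_inj (@perm_inj _ s))/= normr_prod.
by apply: ler_prod => i _; rewrite normr_ge0 MB.
Qed.

(** The image of the rational vector p / q under the affine map given by L
    and y; avoiding these points amounts to avoiding p / q before the map. *)
Definition rational_point (R : realType) (n : nat) (L : 'M[R]_n) (y : 'cV[R]_n)
    (p : 'cV[int]_n) (q : nat) : 'cV[R]_n :=
  L *m (q%:R^-1 *: map_mx intr p) + y.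

(** The determinant of n + 1 rows (1, rational point - z) equals
    det L times an integer divided by the product of the denominators.  If it is
    nonzero it is at least |det L| / Q^(n+1), but it is at most
    (n + 1)! times the product of the half-sides h.  So all such rows are killed
    by one nonzero vector (A0, A).  The linear part A may vanish only if there
    are no such rational points, whence the form of the conclusion. *)
Lemma simplex_lemma (R : realType) (n : nat) (L : 'M[R]_n) (y z : 'cV[R]_n)
    (h : 'I_n -> R) (Q : R) :
  0 < Q -> n.+1`!%:R * \prod_i h i * Q ^+ n.+1 < `|\det L| ->
  exists A0 : R, exists A : 'I_n -> R, (A0 != 0 \/ exists j, A j != 0) /\
    forall p q, (0 < q)%N -> q%:R <= Q ->
      (forall j, `|rational_point L y p q j 0 - z j 0| <= h j) ->
      A0 + \sum_j A j * (rational_point L y p q j 0 - z j 0) = 0.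
Proof.
move=> Q0 hQ.
pose near p q := [/\ (0 < q)%N, q%:R <= Q &
  forall j, `|rational_point L y p q j 0 - z j 0| <= h j].
pose vrow p q : 'rV[R]_(1 + n) := row_mx 1%:M (rational_point L y p q - z)^T.
pose nrow (p : 'cV[int]_n) (q : nat) : 'rV[int]_(1 + n) := row_mx (q%:Z)%:M p^T.
(* Each row (1, rational point - z) is an integer row times T, up to 1/q. *)
pose T : 'M[R]_(1 + n) := block_mx 1%:M (y - z)^T 0 L^T.
have vrowE p q : (0 < q)%N -> vrow p q = q%:R^-1 *: (map_mx intr (nrow p q) *m T).
  move=> q0; have q0' : q%:R != 0 :> R by rewrite pnatr_eq0 -lt0n.
  rewrite map_row_mx mul_row_block mulmx0 addr0 mulmx1 scale_row_mx.
  congr row_mx.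
    by apply/matrixP => i j; rewrite !ord1 !mxE/= !mulr1n mulVf.
  rewrite /rational_point -addrA linearD/= trmx_mul [LHS]addrC scalerDr; congr +%R.
    rewrite map_scalar_mx mul_scalar_mx scalerA mulVf ?scale1r//.
  by rewrite linearZ/= -scalemxAl map_trmx.
have vrow0 p q : vrow p q 0 (lshift n ord0) = 1.
  by rewrite /vrow row_mxEl mxE eqxx.
have vrowS p q j : vrow p q 0 (rshift 1 j) = rational_point L y p q j 0 - z j 0.
  by rewrite /vrow row_mxEr mxE [LHS]mxE [X in _ + X]mxE.
have [|A A0 SA] := @common_annihilator R n.+1
    [set s | exists p q, near p q /\ s = vrow p q].
  move=> M SM; apply: contrapT => /eqP detM0.
  have [p] := choice SM => /choice[q pq].
  pose N : 'M[int]_(1 + n) := \matrix_i nrow (p i) (q i).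
  have ME : M = diag_mx (\row_i (q i)%:R^-1) *m map_mx intr N *m T.
    apply/row_matrixP => i; have [[qi0 _ _] ->] := pq i.
    rewrite vrowE// -mulmxA mul_diag_mx; apply/rowP => j; rewrite !mxE.
    by congr (_ * _); apply: eq_bigr => k _; rewrite !mxE.
  have detE : \det M = (\prod_i (q i)%:R^-1) * (\det N)%:~R * \det L.
    rewrite ME !det_mulmx det_diag det_map_mx /T (@det_ublock _ 1) det1 mul1r det_tr.
    by congr (_ * _ * _); apply: eq_bigr => i _; rewrite mxE.
  have detN : 1 <= `|(\det N)%:~R : R|.
    rewrite norm_intr_ge1 ?intr_int//; apply: contra_neq detM0 => detN0.
    by rewrite detE detN0 mulr0 mul0r.
  have low : Q ^- n.+1 * `|\det L| <= `|\det M|.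
    rewrite detE normrM ler_wpM2r// normrM -[leLHS]mulr1 ler_pM//.
      by rewrite invr_ge0 exprn_ge0// ltW.
    rewrite normr_prod -exprVn -[X in _ ^+ X]card_ord -prodr_const.
    apply: ler_prod => i _; rewrite invr_ge0 ltW//=.
    have [[qi0 qiQ _] _] := pq i.
    by rewrite ger0_norm ?invr_ge0// lef_pV2// ?posrE// ltr0n.
  (* Entrywise bounds by columns: 1 for the first one, then the h j. *)
  pose B (j : 'I_(1 + n)) : R :=
    match fintype.split j with inl _ => 1 | inr j' => h j' end.
  have up : `|\det M| <= n.+1`!%:R * \prod_j h j.
    have -> : \prod_j h j = \prod_j B j.
      rewrite big_split_ord/= big_ord1 {1}/B.
      rewrite (_ : fintype.split _ = inl ord0) ?mul1r; last first.
        by rewrite -[lshift _ _]/(unsplit (inl ord0)) unsplitK.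
      apply: eq_bigr => j _; rewrite /B.
      by rewrite -[rshift _ _]/(unsplit (inr j)) unsplitK.
    apply: norm_det_le => i j; have [[_ _ nr] Mi] := pq i.
    have -> : M i j = vrow (p i) (q i) 0 j by rewrite -Mi mxE.
    rewrite /B /vrow mxE; case: (@fintype.split 1 n j) => j'.
      by rewrite !ord1 mxE eqxx normr1.
    by rewrite !mxE; have := nr j'; rewrite !mxE.
  have := le_trans low up; rewrite mulrC ler_pdivrMr ?exprn_gt0//.
  by rewrite leNgt hQ.
exists (A (@lshift 1 n ord0) 0), (fun j => A (rshift 1 j) 0); split.
  apply: contrapT => /not_orP[/negP/negPn/eqP A00 /forallNP Aj0].
  case/negP: A0; apply/eqP/matrixP => i k; rewrite ord1 mxE.
  have [j ->|j ->] := @split_ordP 1 n i; first by rewrite ord1.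
  by have /negP/negPn/eqP := Aj0 j.
move=> p q q0 qQ nr.
have /matrixP/(_ 0 0) := SA (vrow p q)
  (ex_intro _ p (ex_intro _ q (conj (And3 q0 qQ nr) erefl))).
rewrite mxE [RHS]mxE (@big_split_ord _ _ _ 1 n)/= big_ord1 vrow0 mul1r => {2}<-.
by congr +%R; apply: eq_bigr => j _; rewrite vrowS mulrC.
Qed.

(** * Alice's strategy *)

(** In coordinates centred at Bob's box, a point w of the hyperplane
    satisfies A0 + sum A j * w j = 0.  When A0 >= 0, take for e the signs of A:
    points v of the corner given by e have A j * v j >= |A j| * d j for every j,
    so the form takes at v a value at least sum |A j| * d j, and v and w cannot
    be closer than d j in every coordinate j. *)
Lemma corner_avoids_hyperplane (R : realDomainType) (n : nat)
    (A0 : R) (A : 'I_n -> R) (d : 'I_n -> R) :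
  (A0 != 0 \/ exists j, A j != 0) -> (forall j, 0 < d j) ->
  exists2 e : 'I_n -> R, (forall j, e j = 1 \/ e j = -1) &
    forall v w : 'I_n -> R, (forall j, d j <= e j * v j) ->
      A0 + \sum_j A j * w j = 0 -> exists j, d j <= `|v j - w j|.
Proof.
wlog A00 : A0 A / 0 <= A0 => [hw nz d0|nz d0].
  have [/hw|/ltW A00] := leP 0 A0; first exact.
  have [||//|e e1 he] := hw (- A0) (fun j => - A j); first by rewrite oppr_ge0.
    by case: nz => [?|[j ?]]; [left|right; exists j]; rewrite oppr_eq0.
  exists e => // v w dv vw; apply: he dv _.
  under eq_bigr do rewrite mulNr.
  by rewrite sumrN -opprD vw oppr0.
exists (fun j => if 0 <= A j then 1 else -1) => [j|v w dv vw].
  by case: ifP; [left|right].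
apply: contrapT => /forallNP far.
have near j : `|v j - w j| < d j by rewrite ltNge; apply/negP/far.
have dA j : `|A j| * d j <= A j * v j.
  have := dv j; case: ifPn => Aj; rewrite ?mul1r ?mulN1r => dvj.
    by rewrite ger0_norm// ler_wpM2l.
  rewrite -ltNge in Aj; rewrite ltr0_norm// -[leRHS]mulrNN.
  by rewrite ler_wpM2l// oppr_ge0 ltW.
have up : A0 + \sum_j A j * v j <= \sum_j `|A j| * `|v j - w j|.
  have -> : A0 = - \sum_j A j * w j by apply/eqP; rewrite -addr_eq0 vw.
  rewrite addrC -sumrB.
  by apply: ler_sum => j _; rewrite -mulrBr -normrM ler_norm.
have mid : \sum_j `|A j| * d j <= \sum_j A j * v j by apply: ler_sum.
have low : \sum_j `|A j| * `|v j - w j| <= \sum_j `|A j| * d j.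
  by apply: ler_sum => j _; rewrite ler_wpM2l// ltW.
(* The bounds up, mid and low force A0 = 0, hence some A j is nonzero and
   then low is strict. *)
have A0E : A0 = 0 by apply/eqP; rewrite eq_le A00 andbT; lra.
case: nz => [|[j Aj]]; first by rewrite A0E eqxx.
suff : \sum_j `|A j| * `|v j - w j| < \sum_j `|A j| * d j by lra.
rewrite (bigD1 j)//= [ltRHS](bigD1 j)//= ltr_leD//.
  by rewrite ltr_pM2l ?normr_gt0.
by apply: ler_sum => i _; rewrite ler_wpM2l// ltW.
Qed.

(** Alice's reply, with kappa depending only on n and L.  Rational points within
    one full side of the centre of Bob's box lie on a hyperplane, which she
    avoids by a corner; the others are at distance at least half a side from
    Bob's box, hence from hers. *)
Lemma alice_avoids_rational_points (R : realType) (n : nat) (r : 'I_n -> R) (a : R)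
    (r_sum : \sum_(i < n) r i = 1) (ha : forall i, side r i a < 1 / 2)
    (L : 'M[R]_n) (y : 'cV[R]_n) : L \in unitmx ->
  exists2 kappa : R, 0 < kappa & forall w : 'cV[R]_n * R,
    exists2 x' : 'cV[R]_n, psi_box r (x', w.2 + a) `<=` psi_box r w &
      forall v, psi_box r (x', w.2 + a) v ->
      forall p q, (0 < q)%N -> q%:R <= kappa * expR w.2 ->
      exists j, (1 / 2 - side r j a) * side r j w.2 <=
                `|v j 0 - rational_point L y p q j 0|.
Proof.
move=> Lunit; have detL : 0 < `|\det L|.
  by rewrite normr_gt0; move: Lunit; rewrite unitmxE unitfE.
have f0 : 0 < (n.+1)`!%:R :> R by rewrite ltr0n fact_gt0.
(* kappa <= 1 gives kappa^(n+1) <= kappa, so the hypothesis of the simplex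
   lemma, kappa^(n+1) * (n+1)! < |det L|, follows from the second bound. *)
pose kappa := Num.min 1 (`|\det L| / (n.+1)`!%:R / 2).
have k0 : 0 < kappa by rewrite lt_min ltr01/= !divr_gt0.
exists kappa => // -[z t] /=.
have [] := @simplex_lemma R n L y z (fun j => side r j t) (kappa * expR t).
  by rewrite mulr_gt0 ?expR_gt0.
  have -> : \prod_i side r i t = expR (- t) ^+ n.+1.
    by rewrite prod_side// -expRM_natl mulrN.
  rewrite -mulrA -exprMn mulrCA -expRD addNr expR0 mulr1 mulrC -ltr_pdivlMr//.
  have : kappa ^+ n.+1 <= kappa.
    by rewrite exprS ger_pMr// exprn_ile1// ?ge_min ?lexx// ltW.
  move=> /le_lt_trans; apply; rewrite gt_min ltr_pdivrMr//.
  by rewrite ltr_pMr ?ltr1n ?orbT// divr_gt0.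
move=> A0 [A [nz hA]].
have d0 j : 0 < (1 / 2 - side r j a) * side r j t.
  by rewrite mulr_gt0 ?side_gt0// subr_gt0.
have [e e1 he] := corner_avoids_hyperplane nz d0.
have shift j u : `|u - (z j 0 + e j * (side r j t * (1 - side r j a) / 2))| <=
    side r j (t + a) / 2 -> `|u - z j 0| <= side r j t / 2 /\
  (1 / 2 - side r j a) * side r j t <= e j * (u - z j 0).
  rewrite sideD; have := side_gt0 r j t; have := side_gt0 r j a; have := ha j.
  move: (side r j t) (side r j a) => s b b2 b0 s0.
  by case: (e1 j) => ->; rewrite !ler_norml => /andP[h1 h2]; split; nra.
exists (\col_j (z j 0 + e j * (side r j t * (1 - side r j a) / 2))) => v.
  by move=> /psi_boxP/= vA; apply/psi_boxP => j; have := vA j; rewrite mxE => /shift[].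
move=> /psi_boxP/= vA p q q0 qk.
have [nr|/existsNP[j /negP]] := pselect
    (forall j, `|rational_point L y p q j 0 - z j 0| <= side r j t).
  have vd j : (1 / 2 - side r j a) * side r j t <= e j * (v j 0 - z j 0).
    by have := vA j; rewrite mxE => /shift[].
  have [j] := he (fun j => v j 0 - z j 0) _ vd (hA p q q0 qk nr).
  by rewrite opprB addrA subrK; exists j.
rewrite -ltNge => far; exists j.
have := vA j; rewrite mxE => /shift[vz _].
have := ler_distD (v j 0) (rational_point L y p q j 0) (z j 0).
rewrite (distrC (rational_point L y p q j 0) (v j 0)).
have := mulr_gt0 (side_gt0 r j a) (side_gt0 r j t).
by lra.
Qed.

(** With g / q <= expR (- t), the gap d j * side r j t in coordinate j is at
    least a constant times q^-(1 + r j); dividing by L j j and multiplying by q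
    bounds |q x_j - p_j| below by a constant times q^-(r j). *)
Lemma far_from_rationals_Bad (R : realType) (n : nat) (r : 'I_n -> R) (L : 'M[R]_n)
    (y v : 'cV[R]_n) (d : 'I_n -> R) (g : R) :
  (forall i, 0 < r i) -> is_diag_mx L -> L \in unitmx ->
  (forall i, 0 < d i) -> 0 < g ->
  (forall p q, (0 < q)%N -> exists2 t, g / q%:R <= expR (- t) &
     exists j, d j * side r j t <= `|v j 0 - rational_point L y p q j 0|) ->
  [set L *m x + y | x in Bad r] v.
Proof.
move=> r0 Ldiag Lunit d0 g0 hv.
pose x := invmx L *m (v - y).
have vE : v = L *m x + y by rewrite mulKVmx// subrK.
have LE (u : 'cV[R]_n) j : (L *m u) j 0 = L j j * u j 0.
  rewrite mxE (bigD1 j)//= big1 ?addr0// => i ij.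
  by move/is_diag_mxP: Ldiag => ->; rewrite ?mul0r// eq_sym.
have L0 j : L j j != 0.
  apply: contraTneq Lunit => Ljj.
  rewrite unitmxE unitfE negbK; apply/det0P.
  exists (delta_mx 0 j).
    by apply/negP => /eqP/matrixP/(_ 0 j)/eqP; rewrite !mxE !eqxx oner_eq0.
  rewrite -rowE; apply/rowP => i; rewrite !mxE.
  have [<-//|ji] := eqVneq j i.
  by move/is_diag_mxP: Ldiag => ->.
pose m j := `|L j j|^-1 * d j * g `^ (1 + r j).
have m0 j : 0 < m j by rewrite !mulr_gt0 ?powR_gt0// invr_gt0 normr_gt0.
pose c := \big[Num.min/1]_(j < n) (m j `^ (r j)^-1).
have c0 : 0 < c by apply: lt_bigmin => // j _; exact: powR_gt0.
exists x; last by rewrite -vE.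
exists c => // p q q0.
have q0' : 0 < q%:R :> R by rewrite ltr0n.
have [t gt [j hj]] := hv p q q0.
apply: (@le_trans _ _ (`|q%:R * x j 0 - (p j 0)%:~R| `^ (r j)^-1)); last first.
  exact: le_bigmax.
apply: (@le_trans _ _ (m j `^ (r j)^-1 / q%:R)).
  by rewrite ler_pM2r ?invr_gt0// bigmin_le.
have -> : q%:R^-1 = (q%:R `^ (- r j)) `^ (r j)^-1 :> R.
  by rewrite -powRrM mulNr divff ?gt_eqF// powR_inv1// ltW.
rewrite -powRM ?powR_ge0//; last exact: ltW.
rewrite ge0_ler_powR// ?nnegrE ?invr_ge0 ?mulr_ge0 ?powR_ge0//; try exact: ltW.
have : d j * (g / q%:R) `^ (1 + r j) <= `|L j j| * `|x j 0 - q%:R^-1 * (p j 0)%:~R|.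
  apply: (@le_trans _ _ (d j * side r j t)).
    rewrite ler_pM2l// /side mulNr -mulrN [_ * - t]mulrC expRM.
    rewrite ge0_ler_powR// ?nnegrE ?expR_ge0//.
      by rewrite ltW// addr_gt0.
    by rewrite divr_ge0// ltW.
  apply: le_trans hj _; rewrite -normrM.
  have -> (u : 'cV[R]_n) : v j 0 - u j 0 = (v - u) j 0 by rewrite !mxE.
  rewrite {1}vE /rational_point.
  rewrite opprD addrACA subrr addr0 -mulmxBr LE.
  by rewrite !mxE.
rewrite powRM; [|exact: ltW|by rewrite invr_ge0 ltW].
rewrite -ler_pdivrMl ?normr_gt0// !mulrA -/(m j) => h.
have -> : q%:R * x j 0 - (p j 0)%:~R = q%:R * (x j 0 - q%:R^-1 * (p j 0)%:~R).
  by rewrite mulrBr mulrA divff ?mul1r ?gt_eqF.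
rewrite normrM gtr0_norm//.
apply: le_trans (_ : q%:R * (m j * q%:R^-1 `^ (1 + r j)) <= _); last first.
  by rewrite ler_pM2l.
rewrite mulrCA ler_pM2l// -(powR_inv1 (ltW q0')) -powRrM mulN1r opprD powRD.
  by rewrite (powR_inv1 (ltW q0')) mulrA divff ?mul1r ?gt_eqF.
by rewrite (gt_eqF q0') implybT.
Qed.

Lemma last_mkseq (T : Type) (x : T) (f : nat -> T) k :
  last x (mkseq f k.+1) = f k.
Proof. by rewrite -nth_last size_mkseq nth_mkseq. Qed.

(** A memoryless strategy: at move k (counted from 1), Alice replies to the
    target whose index is the 2-adic valuation of k, so that the i-th target has
    turns at the regular distance 2^(i+1).  At each of its turns all denominators
    up to kappa * expR t are dealt with; for a given q the first suitable turn is
    either the very first one, which costs a constant depending on the play, or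
    comes at most one gap after q exceeded the bound. *)
Lemma Bad_winning (R : realType) (n : nat) (r : 'I_n -> R) (a : R)
    (L : nat -> 'M[R]_n) (y : nat -> 'cV[R]_n) :
  (forall i, 0 < r i) -> \sum_(i < n) r i = 1 ->
  0 < a -> (forall i, side r i a < 1 / 2) ->
  (forall i, is_diag_mx (L i)) -> (forall i, L i \in unitmx) ->
  a_winning (psi_box r) a (\bigcap_i [set L i *m x + y i | x in Bad r]).
Proof.
move=> r0 r_sum a0 ha Ldiag Lunit b b0.
have /choice[kappa /all_and2[kappa0 step]] i : exists kappa : R, 0 < kappa /\
    forall w : 'cV[R]_n * R, exists x' : 'cV[R]_n,
      psi_box r (x', w.2 + a) `<=` psi_box r w /\
      forall v, psi_box r (x', w.2 + a) v ->
      forall p q, (0 < q)%N -> q%:R <= kappa * expR w.2 ->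
      exists j, (1 / 2 - side r j a) * side r j w.2 <=
                `|v j 0 - rational_point (L i) (y i) p q j 0|.
  have [k k0 hk] := alice_avoids_rational_points r_sum ha (y i) (Lunit i).
  by exists k; split=> // w; have [x' h1 h2] := hk w; exists x'.
have {step} /choice[move_ /all_and2[legal avoid]] (iw : nat * ('cV[R]_n * R)) :=
  step iw.1 iw.2.
exists (fun s => move_ (logn 2 (size s), last (0, 0) s)) => omega; split.
  by move=> k _; rewrite /alice_legal /game_le /alice_move last_mkseq; exact: legal.
move=> bob v vomega i _.
pose T := a + b; have T0 : 0 < T by rewrite addr_gt0.
have time k : (omega k).2 = (omega 0%N).2 + k%:R * T.
  elim: k => [|k IH]; first by rewrite mul0r addr0.
  by have [-> _] := bob k; rewrite IH -natr1 /T; ring.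
have valice k : psi_box r (alice_move a
    (fun s => move_ (logn 2 (size s), last (0, 0) s)) omega k) v.
  by have [_] := bob k; apply; exact: vomega.
(* The turns of target i, as indices counted from 0. *)
pose turn m := (2 ^ i * m.*2.+1).-1.
have turnS m : (turn m).+1 = (2 ^ i * m.*2.+1)%N.
  by rewrite prednK// muln_gt0 expn_gt0.
have good m p q : (0 < q)%N -> q%:R <= kappa i * expR (omega (turn m)).2 ->
    exists j, (1 / 2 - side r j a) * side r j (omega (turn m)).2 <=
              `|v j 0 - rational_point (L i) (y i) p q j 0|.
  have := valice (turn m); rewrite /alice_move size_mkseq last_mkseq.
  have -> : logn 2 (turn m).+1 = i.
    by rewrite turnS lognM ?expn_gt0// pfactorK// lognE/= dvdn2/= odd_double addn0.
  by move=> h q0 qk; have := avoid (i, omega (turn m)) v h p q q0 qk.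
pose gap := (2 ^ i.+1)%:R * T.
have turn_gap m : (omega (turn m.+1)).2 = (omega (turn m)).2 + gap.
  rewrite (time (turn m.+1)) (time (turn m)) -addrA -mulrDl -natrD; congr (_ + _%:R * _).
  by apply: succn_inj; rewrite -addSn !turnS doubleS expnS; lia.
apply: (@far_from_rationals_Bad _ _ r (L i) (y i) v (fun j => 1 / 2 - side r j a)
  (Num.min (expR (- (omega (turn 0)).2)) (kappa i * expR (- gap)))) => //.
- by move=> j; rewrite subr_gt0.
- by rewrite lt_min expR_gt0 mulr_gt0 ?expR_gt0.
move=> p q q0; have q0' : 0 < q%:R :> R by rewrite ltr0n.
have reach : exists m, q%:R <= kappa i * expR (omega (turn m)).2.
  have [m hm] : exists m : nat, (ln (q%:R / kappa i) - (omega 0%N).2) / T <= m%:R.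
    exists (Num.truncn ((ln (q%:R / kappa i) - (omega 0%N).2) / T)).+1.
    by rewrite ltW// truncnS_gt.
  exists m; rewrite mulrC -ler_pdivrMr// -[leLHS]lnK ?posrE ?divr_gt0//.
  rewrite ler_expR (time (turn m)) -lerBlDl -ler_pdivrMr//; apply: le_trans hm _.
  by rewrite ler_nat -ltnS turnS; have := expn_gt0 2 i; nia.
case: (ex_minnP reach) => -[|m] hm mmin.
  exists (omega (turn 0)).2; last exact: good.
  by rewrite ler_pdivrMr// ge_min ler_peMr ?expR_ge0// ler1n.
exists (omega (turn m.+1)).2; last exact: good.
have : kappa i * expR (omega (turn m)).2 < q%:R.
  by rewrite ltNge; apply/negP => /mmin; rewrite ltnn.
rewrite turn_gap opprD expRD => h.
rewrite ler_pdivrMr// ge_min; apply/orP; right.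
rewrite [leRHS]mulrAC ler_pM2r ?expR_gt0// expRN ler_pdivlMl ?expR_gt0//.
by rewrite mulrC ltW.
Qed.

(** * A potential for Bob *)

(** The volume of the box for the product of the Stieltjes measures of the
    F j; with clamping functions F j this is the volume of the intersection with
    a fixed box, and additivity becomes a telescoping sum. *)
Definition mass (R : realType) (n : nat) (r : 'I_n -> R) (F : 'I_n -> R -> R)
    (w : 'cV[R]_n * R) : R :=
  \prod_j (F j (upper r w j) - F j (lower r w j)).

Lemma mass_ge0 (R : realType) (n : nat) (r : 'I_n -> R) F w :
  (forall j, {homo F j : x y / x <= y}) -> 0 <= mass r F w.
Proof.
by move=> F0; apply: prodr_ge0 => j _; rewrite subr_ge0 F0// lower_le_upper.
Qed.

Lemma le_mass (R : realType) (n : nat) (r : 'I_n -> R) F w' w :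
  (forall j, {homo F j : x y / x <= y}) -> game_le (psi_box r) w' w ->
  mass r F w' <= mass r F w.
Proof.
move=> F0 /game_le_itv h; apply: ler_prod => j _.
by have [l u] := h j; rewrite subr_ge0 F0 ?lower_le_upper//= lerB ?F0.
Qed.

(** The cell with index f in the grid with the side lengths of time w.2 + b
    laid out from the lower corner of the box w. *)
Definition child (R : realType) (n : nat) (r : 'I_n -> R) (b : R) (K : nat)
    (w : 'cV[R]_n * R) (f : {ffun 'I_n -> 'I_K}) : 'cV[R]_n * R :=
  (\col_j (lower r w j + (f j)%:R * side r j (w.2 + b) + side r j (w.2 + b) / 2),
   w.2 + b).

Lemma lower_child (R : realType) (n : nat) (r : 'I_n -> R) b K w
    (f : {ffun 'I_n -> 'I_K}) j :
  lower r (child r b w f) j = lower r w j + (f j)%:R * side r j (w.2 + b).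
Proof. by rewrite /lower /child/= mxE addrK. Qed.

Lemma upper_child (R : realType) (n : nat) (r : 'I_n -> R) b K w
    (f : {ffun 'I_n -> 'I_K}) j :
  upper r (child r b w f) j = lower r w j + (f j).+1%:R * side r j (w.2 + b).
Proof. by rewrite /upper /child/= mxE -[(f j).+1%:R]natr1; lra. Qed.

Lemma child_le (R : realType) (n : nat) (r : 'I_n -> R) b K w
    (f : {ffun 'I_n -> 'I_K}) (M : 'I_n -> nat) :
  (forall j, (M j)%:R * side r j b <= 1) -> (forall j, (f j < M j)%N) ->
  game_le (psi_box r) (child r b w f) w.
Proof.
move=> Mb fM; apply/game_le_itv => j; rewrite lower_child upper_child.
split; first by rewrite lerDl mulr_ge0// ltW// side_gt0.
rewrite addrC -lerBrDr upper_sub_lower sideD mulrCA -[leRHS]mulr1.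
rewrite ler_pM2l ?side_gt0// (le_trans _ (Mb j))//.
by rewrite ler_pM2r ?side_gt0// ler_nat.
Qed.

(** The sum over the cells is a product of one-dimensional sums, each of which
    telescopes. *)
Lemma sum_mass_child (R : realType) (n : nat) (r : 'I_n -> R) F b K w
    (M : 'I_n -> nat) :
  (forall j, {homo F j : x y / x <= y}) ->
  (forall j, (M j)%:R * side r j b <= 1) -> (forall j, (M j <= K)%N) ->
  \sum_(f in family (fun j => [pred k : 'I_K | (k < M j)%N]))
     mass r F (child r b w f) <= mass r F w.
Proof.
move=> F0 Mb MK.
pose g j (k : nat) := F j (lower r w j + k%:R * side r j (w.2 + b)).
have gS j k : 0 <= g j k.+1 - g j k.
  by rewrite subr_ge0 F0// lerD2l ler_pM2r ?side_gt0// ler_nat.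
have -> : \sum_(f in family (fun j => [pred k : 'I_K | (k < M j)%N]))
      mass r F (child r b w f) =
    \prod_j \sum_(k < K | (k < M j)%N) (g j k.+1 - g j k).
  rewrite bigA_distr_big_dep; apply: eq_bigr => f _.
  by apply: eq_bigr => j _; rewrite lower_child upper_child.
apply: ler_prod => j _; rewrite sumr_ge0//=.
rewrite -(big_ord_widen K (fun k => g j k.+1 - g j k))//.
rewrite -(big_mkord xpredT (fun k => g j k.+1 - g j k)) telescope_sumr//.
rewrite /g mul0r addr0 lerB// F0//.
rewrite addrC -lerBrDr upper_sub_lower sideD mulrCA -[leRHS]mulr1.
by rewrite ler_pM2l ?side_gt0.
Qed.

Lemma card_children (K n : nat) (M : 'I_n -> nat) : (forall j, (M j <= K)%N) ->
  #|family (fun j => [pred k : 'I_K | (k < M j)%N])| = (\prod_j M j)%N.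
Proof.
move=> MK; rewrite -sum1_card.
transitivity (\prod_j \sum_(k < K | (k < M j)%N) 1)%N.
  by rewrite bigA_distr_big_dep; apply: eq_bigr => f _; rewrite big1_eq.
apply: eq_bigr => j _; rewrite -(big_ord_widen K (fun=> 1%N))//.
by rewrite sum1_card card_ord.
Qed.

(** The ratio is, up to the coefficient c m, the proportion of the box w that
    the m-th set fills. *)
Definition potential (R : realType) (n : nat) (r : 'I_n -> R)
    (c : nat -> R) (F : nat -> 'I_n -> R -> R) (w : 'cV[R]_n * R) : \bar R :=
  (\sum_(0 <= m <oo) (c m * mass r (F m) w / \prod_j side r j w.2)%:E)%E.

(** Over the product of the M j cells in the box w', the potentials add up to at
    most (product of M j) * D times the potential of w, since the total mass does
    not increase while the volume of a box is divided by that of a box of time T.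
    So the cells cannot all have potential at least D * C. *)
Lemma small_potential_child (R : realType) (n : nat) (r : 'I_n -> R) (b T C D : R)
    (M : 'I_n -> nat) c F w w' :
  (forall m, 0 <= c m) -> (forall m j, {homo F m j : x y / x <= y}) ->
  (forall j, (0 < M j)%N) -> (forall j, (M j)%:R * side r j b <= 1) ->
  w'.2 + b = w.2 + T -> game_le (psi_box r) w' w ->
  (\prod_j (M j)%:R)^-1 / \prod_j side r j T <= D ->
  (potential r c F w < C%:E)%E ->
  exists w'', [/\ w''.2 = w'.2 + b, game_le (psi_box r) w'' w' &
                  (potential r c F w'' < (D * C)%:E)%E].
Proof.
move=> c0 F0 M0 Mb time le DM small.
pose K := (\sum_j M j)%N.
have MK j : (M j <= K)%N by rewrite /K (bigD1 j)//= leq_addr.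
pose fam := family (fun j => [pred k : 'I_K | (k < M j)%N]).
apply: contrapT => noW.
have big f : f \in fam -> ((D * C)%:E <= potential r c F (child r b w' f))%E.
  move=> /familyP ff; rewrite leNgt; apply/negP => lt; apply: noW.
  by exists (child r b w' f); split => //; exact: (child_le Mb).
have V0 t : 0 < \prod_j side r j t by apply: prodr_gt0 => j _; exact: side_gt0.
have prodM : \prod_j (M j)%:R = #|fam|%:R :> R by rewrite card_children// natr_prod.
have fam0 : 0 < #|fam|%:R :> R.
  by rewrite -prodM; apply: prodr_gt0 => j _; rewrite ltr0n.
have term0 m w1 : 0 <= c m * mass r (F m) w1 / \prod_j side r j w1.2.
  by rewrite divr_ge0 ?mulr_ge0 ?mass_ge0 ?(ltW (V0 _)).
have lowb : ((#|fam|%:R * (D * C))%:E <=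
    \sum_(f in fam) potential r c F (child r b w' f))%E.
  have -> : (#|fam|%:R * (D * C))%:E = (\sum_(f in fam) (D * C)%:E)%E.
    by rewrite sumEFin sumr_const mulr_natl.
  exact: lee_sum.
have D0 : 0 < D.
  by apply: lt_le_trans DM; rewrite prodM divr_gt0// invr_gt0.
have upb : (\sum_(f in fam) potential r c F (child r b w' f) <=
    (#|fam|%:R * D)%:E * potential r c F w)%E.
  rewrite -nneseries_sum; last by move=> f m _; rewrite lee_fin.
  rewrite -nneseriesZl; last by move=> m _; rewrite lee_fin.
  apply: lee_nneseries => m _; first by rewrite sumEFin lee_fin sumr_ge0.
  rewrite sumEFin -EFinM lee_fin /= time.
  rewrite -mulr_suml -mulr_sumr.
  have -> : \prod_j side r j (w.2 + T) = \prod_j side r j w.2 * \prod_j side r j T.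
    by rewrite -big_split/=; apply: eq_bigr => j _; rewrite sideD.
  rewrite invfM mulrA mulrC ler_pM ?invr_ge0 ?(ltW (V0 _))//.
  - by rewrite divr_ge0 ?(ltW (V0 _))// mulr_ge0// sumr_ge0// => f _; exact: mass_ge0.
  - by move: DM; rewrite prodM ler_pdivrMl.
  rewrite ler_pM2r ?invr_gt0// ler_wpM2l//.
  exact: le_trans (sum_mass_child _ _ _ _) (le_mass _ le).
have := le_trans lowb upb; rewrite leNgt mulrA => /negP; apply.
by rewrite [ltRHS]EFinM lte_pmul2l// lte_fin mulr_gt0.
Qed.

(** * Winning sets are not covered by small balls *)

Lemma nneseries_ge_term (R : realType) (f : nat -> \bar R) m :
  (forall k, (0 <= f k)%E) -> (f m <= \sum_(0 <= k <oo) f k)%E.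
Proof.
by move=> f0; rewrite (@nneseriesD1 _ f m)// leeDl// nneseries_ge0.
Qed.

Definition clamp (R : realDomainType) (lo hi x : R) : R := Num.max lo (Num.min hi x).

Lemma le_clamp (R : realDomainType) (lo hi : R) :
  {homo clamp lo hi : x y / x <= y}.
Proof. by move=> x y xy; rewrite le_max2 ?le_min2. Qed.

Lemma clamp_itv (R : realDomainType) (lo hi x : R) :
  lo <= hi -> lo <= clamp lo hi x <= hi.
Proof. by move=> lohi; rewrite le_max lexx ge_max lohi ge_min lexx. Qed.

Lemma clamp_id (R : realDomainType) (lo hi x : R) :
  lo <= x <= hi -> clamp lo hi x = x.
Proof. by move=> /andP[lox xhi]; rewrite /clamp min_r// max_r. Qed.

(** Bob's moves are legal whether or not Alice's are, so the whole play can be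
    defined first; the legality of Alice's moves, and with it the bound on the
    potential, comes afterwards from her strategy. *)
Lemma low_potential_play (R : realType) (n : nat) (r : 'I_n -> R) (a b D : R)
    (M : 'I_n -> nat) S c F w0 :
  (forall m, 0 <= c m) -> (forall m j, {homo F m j : x y / x <= y}) ->
  (forall j, (0 < M j)%N) -> (forall j, (M j)%:R * side r j b <= 1) ->
  (\prod_j (M j)%:R)^-1 / \prod_j side r j (a + b) <= D ->
  ab_winning (psi_box r) a b S ->
  (potential r c F w0 < 1)%E ->
  exists (omega : nat -> 'cV[R]_n * R) v, [/\ omega 0%N = w0, S v,
    forall k, psi_box r (omega k) v,
    forall k, (omega k).2 = w0.2 + k%:R * (a + b) &
    forall k, (potential r c F (omega k) < (D ^+ k)%:E)%E].
Proof.
move=> c0 F0 M0 Mb DM [sigma win] start.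
have /choice[next nextP] (s : seq ('cV[R]_n * R)) : exists w'',
    [/\ w''.2 = (last w0 s).2 + a + b,
        game_le (psi_box r) w'' (sigma s, (last w0 s).2 + a) &
        game_le (psi_box r) (sigma s, (last w0 s).2 + a) (last w0 s) ->
        (potential r c F (last w0 s) < (D ^+ (size s).-1)%:E)%E ->
        (potential r c F w'' < (D ^+ (size s).-1.+1)%:E)%E].
  set w := last w0 s; set w' := (sigma s, _).
  have time : w'.2 + b = w.2 + (a + b) by rewrite addrA.
  have [[le small]|nle] := pselect (game_le (psi_box r) w' w /\
      (potential r c F w < (D ^+ (size s).-1)%:E)%E).
    have [w'' [h1 h2 h3]] := small_potential_child c0 F0 M0 Mb time le DM small.
    by exists w''; split => //; rewrite exprS.
  pose f : {ffun 'I_n -> 'I_1} := [ffun=> ord0].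
  exists (child r b w' f); split => //.
    by apply: (child_le Mb) => j; rewrite ord1; exact: M0.
  by move=> le small; case: nle.
pose hist := fix hist k :=
  if k is k'.+1 then rcons (hist k') (next (hist k')) else [:: w0].
pose omega k := last w0 (hist k).
have omegaS k : omega k.+1 = next (hist k) by rewrite /omega/= last_rcons.
have size_hist k : size (hist k) = k.+1.
  by elim: k => //= k IH; rewrite size_rcons IH.
have histE k : mkseq omega k.+1 = hist k.
  by elim: k => //= k IH; rewrite mkseqS IH omegaS.
have bob k : bob_legal (psi_box r) a b sigma omega k.
  rewrite /bob_legal /alice_move histE omegaS.
  by have [] := nextP (hist k).
have alice k : game_le (psi_box r) (sigma (hist k), (omega k).2 + a) (omega k).
  have [/(_ k (fun j _ => bob j))] := win omega.
  by rewrite /alice_legal /alice_move histE.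
have [v hv] : exists v, forall k, psi_box r (omega k) v.
  apply: nested_boxes_meet => k v vk; apply: (alice k).
  by have [_] := bob k; rewrite /alice_move histE; apply.
exists omega, v; split => //.
- by have [_ /(_ bob)] := win omega; apply => k _; exact: hv.
- elim=> [|k IH]; first by rewrite mul0r addr0.
  by have [-> _] := bob k; rewrite IH -natr1; ring.
- elim=> [|k IH]; first by rewrite expr0.
  have [_ _] := nextP (hist k); rewrite -omegaS size_hist.
  by apply.
Qed.

(** Put eps = n - s and choose b with D = expR (eps * (a + b)).  The m-th ball
    gets the coefficient D^(K m), where K m is the first stage at which sides are
    below d m, up to bounded error; this coefficient is of order (d m)^(-eps), so
    the potential of the initial box is of order the sum of the
    (d m)^(n - eps) = (d m)^s. *)
Lemma winning_not_covered (R : realType) (n : nat) (r : 'I_n -> R) (a s : R)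
    (S : set 'cV[R]_n) (w0 : 'cV[R]_n * R) :
  (forall i, 0 < r i) -> \sum_(i < n) r i = 1 -> 0 < a ->
  a_winning (psi_box r) a S -> 0 <= w0.2 -> 0 < s < n%:R ->
  exists2 e : R, 0 < e & forall (u : nat -> 'cV[R]_n) (d : nat -> R),
    (forall m, 0 < d m) -> (\sum_(0 <= m <oo) (d m `^ s)%:E <= e%:E)%E ->
    exists v, [/\ S v, psi_box r w0 v & forall m, exists j, d m < `|v j 0 - u m j 0|].
Proof.
move=> r0 r_sum a0 win t0 /andP[s0 sn].
pose eps := n%:R - s; have eps0 : 0 < eps by rewrite subr_gt0.
(* Rounding down to the integers M j loses at most a factor 2 in each
   coordinate, and Alice's move loses expR ((n + 1) a); this b makes both together
   at most expR (eps * b). *)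
pose b := (n.+1%:R * a + n%:R * ln 2) / eps.
have b0 : 0 < b.
  by rewrite divr_gt0// ltr_wpDr ?mulr_gt0// mulr_ge0// ln_ge0// ler1n.
pose T := a + b; have T0 : 0 < T by rewrite addr_gt0.
pose M j := Num.truncn (expR ((1 + r j) * b)).
have M0 j : (0 < M j)%N.
  rewrite truncn_gt0 -expR0 ler_expR mulr_ge0// ?ltW//.
  by rewrite ltr_wpDr// ltW.
have Mb j : (M j)%:R * side r j b <= 1.
  rewrite /side mulNr expRN ler_pdivrMr ?expR_gt0// mul1r.
  by rewrite truncn_le// expR_ge0.
have Mlow j : expR ((1 + r j) * b) / 2 <= (M j)%:R.
  have := truncnS_gt (expR ((1 + r j) * b)); rewrite -/(M j) -natr1.
  have : 1 <= (M j)%:R :> R by rewrite ler1n.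
  by lra.
pose D := expR (eps * T).
have DM : (\prod_j (M j)%:R)^-1 / \prod_j side r j (a + b) <= D.
  rewrite prod_side// expRN invrK mulrC ler_pdivrMr; last first.
    by apply: prodr_gt0 => j _; rewrite ltr0n.
  apply: (@le_trans _ _ (D * \prod_j (expR ((1 + r j) * b) / 2))); last first.
    rewrite ler_pM2l ?expR_gt0//; apply: ler_prod => j _.
    by rewrite Mlow divr_ge0// expR_ge0.
  have -> : \prod_j (expR ((1 + r j) * b) / 2) = expR (n.+1%:R * b - n%:R * ln 2).
    have -> : \prod_j (expR ((1 + r j) * b) / 2) =
        \prod_(j < n) expR ((1 + r j) * b - ln 2).
      by apply: eq_bigr => j _; rewrite expRD expRN lnK// posrE.
    rewrite -expR_sum; congr expR.
    rewrite sumrB -mulr_suml big_split/= r_sum !sumr_const card_ord.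
    by rewrite -[n.+1]addn1 natrD mulr_natl; ring.
  rewrite /D -expRD ler_expR.
  have : eps * b = n.+1%:R * a + n%:R * ln 2 by rewrite /b mulrC divfK ?gt_eqF.
  have : 0 < eps * a by rewrite mulr_gt0.
  by rewrite /T; lra.
pose V := \prod_j side r j w0.2.
have V0 : 0 < V by apply: prodr_gt0 => j _; exact: side_gt0.
pose B := D * 4 ^+ n / V.
have B0 : 0 < B by rewrite divr_gt0// mulr_gt0 ?expR_gt0// exprn_gt0.
exists (Num.min 1 (2 * B)^-1); first by rewrite lt_min ltr01 invr_gt0 mulr_gt0.
move=> u d d0 dsum.
have d1 m : d m <= 1.
  rewrite leNgt; apply/negP => dm.
  have : ((d m `^ s)%:E <= (Num.min 1 (2 * B)^-1)%:E)%E.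
    apply: le_trans dsum; apply: (@nneseries_ge_term _ (fun m => (d m `^ s)%:E)).
    by move=> i; rewrite lee_fin powR_ge0.
  rewrite lee_fin le_min => /andP[+ _]; apply/negP; rewrite -ltNge.
  by rewrite /powR gt_eqF// -expR0 ltr_expR mulr_gt0// ln_gt0.
pose K m := (Num.truncn (- ln (d m) / T)).+1.
have lnd m : 0 <= - ln (d m) by rewrite oppr_ge0 ln_le0.
have Kd m : expR (- ((K m)%:R * T)) < d m.
  rewrite -[ltRHS]lnK ?posrE// ltr_expR ltrNl -ltr_pdivrMr//.
  exact: truncnS_gt.
have DK m : D ^+ K m <= D * d m `^ (- eps).
  rewrite /K exprS ler_pM2l ?expR_gt0// -expRM_natl.
  rewrite /powR gt_eqF// ler_expR.
  rewrite mulrCA [leRHS]mulNr -[leRHS]mulrN (ler_pM2l eps0).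
  by rewrite -ler_pdivlMr// truncn_le// divr_ge0// ltW.
(* Doubling the radius makes room for a box of side at most d m that meets
   the ball. *)
pose F m j := clamp (u m j 0 - 2 * d m) (u m j 0 + 2 * d m).
have F0 m j : {homo F m j : x y / x <= y} by exact: le_clamp.
pose c m := D ^+ K m.
have c0 m : 0 <= c m by rewrite exprn_ge0// expR_ge0.
have start : (potential r c F w0 < 1)%E.
  apply: (@le_lt_trans _ _ (\sum_(0 <= m <oo) (B%:E * (d m `^ s)%:E))%E).
    apply: lee_nneseries => m _.
      by rewrite lee_fin divr_ge0 ?mulr_ge0 ?mass_ge0 ?(ltW V0).
    rewrite -EFinM lee_fin -/V /B [leRHS]mulrAC ler_pM2r ?invr_gt0//.
    have -> : d m `^ s = d m `^ (- eps) * d m ^+ n.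
      rewrite -powR_mulrn ?ltW// -powRD; last by rewrite (gt_eqF (d0 m)) implybT.
      by congr (_ `^ _); rewrite /eps; ring.
    rewrite mulrACA -exprMn; apply: ler_pM => //; [exact: mass_ge0|exact: DK|].
    rewrite -[X in _ ^+ X]card_ord -prodr_const; apply: ler_prod => j _.
    rewrite subr_ge0 F0 ?lower_le_upper//=.
    have ends : u m j 0 - 2 * d m <= u m j 0 + 2 * d m by have := d0 m; lra.
    have := clamp_itv (upper r w0 j) ends; have := clamp_itv (lower r w0 j) ends.
    by rewrite /F; lra.
  rewrite nneseriesZl; last by move=> m _; rewrite lee_fin powR_ge0.
  apply: (@le_lt_trans _ _ (B%:E * ((2 * B)^-1)%:E)%E).
    rewrite lee_pmul2l//; apply: le_trans dsum _.
    by rewrite lee_fin ge_min lexx orbT.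
  by rewrite -EFinM lte_fin invfM mulrCA divff ?gt_eqF// mulr1 invf_lt1 ?ltr1n.
have [omega [v [omega0 Sv vomega time small]]] :=
  low_potential_play c0 F0 M0 Mb DM (win b b0) start.
exists v; split => //; first by rewrite -omega0.
move=> m; apply: contrapT => /forallNP near.
have vu j : `|v j 0 - u m j 0| <= d m by rewrite leNgt; apply/negP/near.
have := small (K m); rewrite ltNge => /negP; apply.
have -> : ((D ^+ K m)%:E =
    (c m * mass r (F m) (omega (K m)) / \prod_j side r j (omega (K m)).2)%:E)%E.
  rewrite -mulrA [mass _ _ _](_ : _ = \prod_j side r j (omega (K m)).2).
    by rewrite divff ?mulr1// gt_eqF//; apply: prodr_gt0 => j _; exact: side_gt0.
  apply: eq_bigr => j _; rewrite -upper_sub_lower.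
  have side_le : side r j (omega (K m)).2 <= d m.
    apply: le_trans (ltW (Kd m)); rewrite ler_expR time -/T mulNr lerN2.
    apply: (@le_trans _ _ (1 * (w0.2 + (K m)%:R * T))); first by rewrite mul1r lerDr.
    rewrite ler_wpM2r ?lerDl ?(ltW (r0 j))//.
    by rewrite addr_ge0// mulr_ge0// ltW.
  have /psi_box_itv/(_ j)/andP[lv vu'] := vomega (K m).
  have := vu j; rewrite ler_norml => /andP[vl vu''].
  have len := upper_sub_lower r (omega (K m)) j.
  by rewrite /F !clamp_id//; apply/andP; split; lra.
apply: (@nneseries_ge_term _ (fun m => (c m * mass r (F m) _ / _)%:E)) => i.
rewrite lee_fin divr_ge0 ?mulr_ge0 ?mass_ge0//.
by rewrite prodr_ge0// => j _; rewrite ltW// side_gt0.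
Qed.

(** * Hausdorff dimension *)

Lemma coord_le_norm (R : realType) (n : nat) (x : 'cV[R]_n) j : `|x j 0| <= `|x|.
Proof.
rewrite [leRHS]/Num.Def.normr/= mx_normrE.
exact: (le_bigmax _ (fun ij : 'I_n * 'I_1 => `|x ij.1 ij.2|) (j, 0)).
Qed.

Lemma norm_le_coord (R : realType) (n : nat) (x : 'cV[R]_n) d :
  0 <= d -> (forall j, `|x j 0| <= d) -> `|x| <= d.
Proof.
move=> d0 xd; rewrite [leLHS]/Num.Def.normr/= mx_normrE.
by apply: bigmax_le => // -[i j] _; rewrite ord1 xd.
Qed.

Section Hausdorff.
Variables (R : realType) (V : normedModType R).
Implicit Types (A C : set V) (s d : R).

Lemma diameter_le C d : (forall x y, C x -> C y -> `|x - y| <= d) ->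
  (diameter C <= d%:E)%E.
Proof.
by move=> Cd; apply: ge_ereal_sup => _ [[x y] [Cx Cy] <-]; rewrite lee_fin Cd.
Qed.

Lemma diameter_ge C x y : C x -> C y -> ((`|x - y|)%:E <= diameter C)%E.
Proof. by move=> Cx Cy; apply: ereal_sup_ubound; exists (x, y). Qed.

Lemma diameter_ge0 C : C !=set0 -> (0 <= diameter C)%E.
Proof. by move=> [x Cx]; have := diameter_ge Cx Cx; rewrite subrr normr0. Qed.

Lemma hausdorff_weight_ge0 s C : (0 <= hausdorff_weight s C)%E.
Proof. by rewrite /hausdorff_weight; case: ifP => // _; exact: poweR_ge0. Qed.

Lemma hausdorff_weight_le C s d : 0 <= s ->
  (forall x y, C x -> C y -> `|x - y| <= d) -> (hausdorff_weight s C <= (d `^ s)%:E)%E.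
Proof.
move=> s0 Cd; rewrite /hausdorff_weight; case: asboolP => [_|/eqP/set0P C0].
  by rewrite lee_fin powR_ge0.
have Cd' := diameter_le Cd; have Cge := diameter_ge0 C0.
rewrite -poweR_EFin; apply: gt0_ler_poweR => //; rewrite in_itv/= leey ?Cge//.
by rewrite (le_trans Cge).
Qed.

(** For diameters at most 1 a weight can only decrease when its exponent
    increases; this reduces exponent 0, where points have weight 1, to positive
    exponents. *)
Lemma diameter_le_weight C s s' : 0 <= s <= s' -> 0 < s' ->
  (diameter C <= 1)%E ->
  forall x y, C x -> C y -> `|x - y| `^ s' <= fine (hausdorff_weight s C).
Proof.
move=> /andP[s0 ss'] s'0 C1 x y Cx Cy.
have C0 : C !=set0 by exists x.
have xy := diameter_ge Cx Cy; have d0 := diameter_ge0 C0.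
rewrite /hausdorff_weight; case: asboolP => [C0'|_].
  by move: Cx; rewrite C0'.
case: (diameter C) C1 xy d0 => [d|//|//]; rewrite !lee_fin => d1 xyd d0.
rewrite poweR_EFin/=.
apply: (@le_trans _ _ (d `^ s')); first by rewrite ge0_ler_powR ?nnegrE// ltW.
move: d0; rewrite le_eqVlt => /predU1P[<-|d0].
  by rewrite powR0 ?gt_eqF// powR_ge0.
by rewrite ger_powR// d0.
Qed.

Lemma hausdorff_premeasure_ge0 s d A : (0 <= hausdorff_premeasure s d A)%E.
Proof.
apply: le_ereal_inf_tmp => _ [U _ <-]; apply: nneseries_ge0 => k _ _.
exact: hausdorff_weight_ge0.
Qed.

End Hausdorff.

Lemma nneseries_prefix (R : realType) (N : nat) (c : R) : 0 <= c ->
  (\sum_(0 <= i <oo) (if (i < N)%N then c%:E else 0) = (N%:R * c)%:E)%E.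
Proof.
move=> c0; rewrite (@nneseries_split _ _ 0 N); last first.
  by move=> k _; case: ifP => // _; rewrite lee_fin.
rewrite add0n [X in (_ + X)%E]eseries0 ?adde0; last first.
  by move=> k Nk _; rewrite ltnNge Nk.
rewrite big_mkord (eq_bigr (fun=> c%:E)) => [|i _]; last by rewrite ltn_ord.
by rewrite sumEFin sumr_const card_ord mulr_natl.
Qed.

(** For all f, these cubes of side 1 / K tile the cube of half-side m
    centred at 0. *)
Definition grid_cell (R : realType) (n m K : nat) (f : {ffun 'I_n -> 'I_(2 * m * K)}) :
  set 'cV[R]_n :=
  [set x | forall j, (f j)%:R / K%:R <= x j 0 + m%:R <= (f j).+1%:R / K%:R].

Lemma grid_cell_small (R : realType) (n m K : nat)
    (f : {ffun 'I_n -> 'I_(2 * m * K)}) (x y : 'cV[R]_n) :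
  grid_cell f x -> grid_cell f y -> `|x - y| <= K%:R^-1.
Proof.
move=> fx fy; apply: norm_le_coord => [|j]; first by rewrite invr_ge0.
have := fx j; have := fy j; rewrite !mxE -natr1 mulrDl div1r ler_norml.
by move=> /andP[? ?] /andP[? ?]; apply/andP; split; lra.
Qed.

Lemma grid_cell_cover (R : realType) (n m K : nat) (x : 'cV[R]_n) : (0 < K)%N ->
  (forall j, `|x j 0| < m%:R) ->
  exists f : {ffun 'I_n -> 'I_(2 * m * K)}, grid_cell f x.
Proof.
move=> K0 xm; have K0' : 0 < K%:R :> R by rewrite ltr0n.
have fl j : (Num.truncn ((x j 0 + m%:R) * K%:R)%R < 2 * m * K)%N.
  have := xm j; rewrite ltr_norml => /andP[lo hi].
  rewrite truncn_lt_nat; last by rewrite mulr_ge0//; lra.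
  by rewrite !natrM ltr_pM2r//; lra.
exists [ffun j => Ordinal (fl j)] => j; rewrite ffunE/=.
rewrite ler_pdivrMr// ler_pdivlMr//; apply/andP; split; last exact/ltW/truncnS_gt.
rewrite truncn_le.
by have := xm j; rewrite ltr_norml => /andP[lo hi]; rewrite mulr_ge0//; lra.
Qed.

(** The m-th cube of half-side m needs (2 m K)^n cells of weight K^-s, a total
    that tends to 0 as K grows since s > n; so the cells of all the cubes
    together can have total weight at most e. *)
Lemma hausdorff_measure_gt_dim (R : realType) (n : nat) (s : R) (A : set 'cV[R]_n) :
  n%:R < s -> hausdorff_measure s A = 0%E.
Proof.
move=> ns; have s0 : 0 < s by apply: le_lt_trans ns.
suff pre0 d : 0 < d -> hausdorff_premeasure s d A = 0%E.
  rewrite /hausdorff_measure; apply/eqP; rewrite eq_le; apply/andP; split.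
    by apply: ge_ereal_sup => _ [d d0 <-]; rewrite pre0.
  by apply: ereal_sup_ubound; exists 1 => //=; rewrite pre0.
move=> d0; apply/eqP; rewrite eq_le hausdorff_premeasure_ge0 andbT.
apply/lee_addgt0Pr => e e0; rewrite add0e.
have /choice[K /all_and3[K0 Kd Ke]] m : exists K : nat, [/\ (0 < K)%N, K%:R^-1 <= d &
    ((2 * m * K) ^ n)%:R * K%:R^-1 `^ s <= e / (2 ^ m.+1)%:R].
  pose g := s - n%:R; have g0 : 0 < g by rewrite subr_gt0.
  pose z := ((2 * m) ^ n)%N.
  pose q := e / (2 ^ m.+1)%:R / z.+1%:R.
  have q0 : 0 < q by rewrite !divr_gt0// ltr0n expn_gt0.
  pose K := (Num.truncn (Num.max d^-1 ((q `^ g^-1)^-1))).+1.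
  have : Num.max d^-1 ((q `^ g^-1)^-1) < K%:R by exact: truncnS_gt.
  rewrite gt_max => /andP[dK qK]; have K0 : 0 < K%:R :> R by rewrite ltr0n.
  exists K; split => //; first by rewrite invf_ple ?posrE// ltW.
  have small : K%:R^-1 `^ g <= q.
    have -> : q = (q `^ g^-1) `^ g by rewrite -powRrM mulVf ?gt_eqF// powRr1// ltW.
    rewrite ge0_ler_powR ?nnegrE ?powR_ge0 ?invr_ge0// ?(ltW g0)//.
    by rewrite invf_ple ?posrE ?powR_gt0// ltW.
  have -> : K%:R^-1 `^ s = K%:R^-1 ^+ n * K%:R^-1 `^ g.
    rewrite -powR_mulrn ?invr_ge0// -powRD; last by rewrite invr_eq0 (gt_eqF K0) implybT.
    by congr (_ `^ _); rewrite /g; ring.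
  rewrite expnMn natrM -/z natrX -mulrA (mulrA (K%:R ^+ n)) -exprMn divff ?gt_eqF//.
  rewrite expr1n mul1r; apply: (@le_trans _ _ (z%:R * q)); first by rewrite ler_wpM2l.
  rewrite /q mulrC mulrAC -mulrA ler_piMr//; first by rewrite divr_ge0// ltW.
  by rewrite ler_pdivrMr ?ltr0n// mul1r ler_nat.
(* The cells of the m-th cube, enumerated by natural numbers and continued by
   the empty set, which has weight 0. *)
pose cell (mi : nat * nat) : set 'cV[R]_n :=
  if insub mi.2 is Some i
  then grid_cell (enum_val (i : 'I_#|{ffun 'I_n -> 'I_(2 * mi.1 * K mi.1)}|))
  else set0.
have card_cells m : #|{ffun 'I_n -> 'I_(2 * m * K m)}| = ((2 * m * K m) ^ n)%N.
  by rewrite card_ffun !card_ord.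
have cell_small mi x y : cell mi x -> cell mi y -> `|x - y| <= (K mi.1)%:R^-1.
  by rewrite /cell; case: insubP => // i _ _; exact: grid_cell_small.
have cell_weight m i : (hausdorff_weight s (cell (m, i)) <=
    if (i < (2 * m * K m) ^ n)%N then ((K m)%:R^-1 `^ s)%:E else 0)%E.
  case: ifPn => im.
    apply: hausdorff_weight_le => [|x y]; first exact: ltW.
    exact: (cell_small (m, i)).
  rewrite /cell/= insubN ?card_cells// /hausdorff_weight.
  by case: asboolP.
have /card_esym/ppcard_eqP[h] := card_nat2.
apply: (@le_trans _ _ (\sum_(0 <= k <oo) hausdorff_weight s (cell (h k)))%E).
  apply: ereal_inf_lbound; exists (cell \o h) => //; split=> [x _|k]; last first.
    by apply: diameter_le => x y cx cy; exact: le_trans (cell_small _ _ _ cx cy) (Kd _).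
  have [m xm] : exists m : nat, forall j, `|x j 0| < m%:R.
    exists (Num.truncn `|x|).+1 => j.
    exact: le_lt_trans (coord_le_norm _ _) (truncnS_gt _).
  have [f fx] := @grid_cell_cover _ _ _ _ x (K0 m) xm.
  have [k _ hk] : exists2 k, setT k & h k = (m, enum_rank f : nat) by apply: surj.
  exists k => //=; rewrite hk /cell/=.
  rewrite (insubT (fun i => (i < _)%N) (ltn_ord (enum_rank f))) /= /Sub/=.
  by rewrite (_ : Ordinal _ = enum_rank f) ?enum_rankK//; exact: val_inj.
rewrite nneseries_esumT; last by move=> k; exact: hausdorff_weight_ge0.
rewrite -(reindex_esum [set: nat] [set: nat * nat] h
  (fun mi => hausdorff_weight s (cell mi)))//.
rewrite (_ : [set: nat * nat] = [set: nat] `*`` fun=> [set: nat]); last by apply/seteqP; split.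
have -> : (\esum_(mi in [set: nat] `*`` fun=> [set: nat])
      hausdorff_weight s (cell mi) =
    \esum_(m in [set: nat]) \esum_(i in [set: nat])
      hausdorff_weight s (cell (m, i)))%E.
  rewrite esum_esum; last by move=> *; exact: hausdorff_weight_ge0.
  by apply: eq_esum => -[].
rewrite -nneseries_esumT; last first.
  by move=> m; apply: esum_ge0 => i _; exact: hausdorff_weight_ge0.
apply: le_trans (epsilon_trick0 xpredT (ltW e0)).
apply: lee_nneseries => [m _ _|m _].
  by apply: esum_ge0 => i _; exact: hausdorff_weight_ge0.
rewrite -nneseries_esumT; last by move=> i; exact: hausdorff_weight_ge0.
apply: (@le_trans _ _ (\sum_(0 <= i <oo)
    (if (i < (2 * m * K m) ^ n)%N then ((K m)%:R^-1 `^ s)%:E else 0))%E).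
  by apply: lee_nneseries => [i _ _|i _]; [exact: hausdorff_weight_ge0|exact: cell_weight].
by rewrite nneseries_prefix ?powR_ge0// lee_fin Ke.
Qed.

Lemma box_in_open (R : realType) (n : nat) (r : 'I_n -> R) (U : set 'cV[R]_n) :
  (forall i, 0 < r i) -> open U -> U !=set0 ->
  exists2 w : 'cV[R]_n * R, 0 <= w.2 & psi_box r w `<=` U.
Proof.
move=> r0 oU [p Up].
have [e /= e0 eU] : nbhs_ball p U by rewrite nbhs_ballE; exact: open_nbhs_nbhs.
pose t := Num.max 0 (- ln e).
have t0 : 0 <= t by rewrite le_max lexx.
exists (p, t) => // v /psi_boxP /= pv; apply: eU; rewrite -ball_normE /ball_ /=.
apply: (@le_lt_trans _ _ (e / 2)); last by rewrite ltr_pdivrMr// ltr_pMr// ltr1n.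
apply: norm_le_coord => [|j]; first by rewrite divr_ge0// ltW.
rewrite !mxE distrC (le_trans (pv j))// ler_pM2r// -[leRHS]lnK ?posrE// ler_expR.
apply: (@le_trans _ _ (- t)); last by rewrite lerNl le_max lexx orbT.
by rewrite mulNr lerN2 ler_peMl// lerDl ltW.
Qed.

(** A cover with small s-weights becomes a family of balls whose radii have a
    small sum of s'-th powers, for s' halfway between s and n: a set of diameter 0
    gets a positive radius from a convergent geometric series. *)
Lemma winning_hausdorff_measure (R : realType) (n : nat) (r : 'I_n -> R) (a s : R)
    (S U : set 'cV[R]_n) :
  (forall i, 0 < r i) -> \sum_(i < n) r i = 1 -> 0 < a ->
  a_winning (psi_box r) a S -> open U -> U !=set0 -> 0 <= s < n%:R ->
  hausdorff_measure s (S `&` U) != 0%E.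
Proof.
move=> r0 r_sum a0 win oU U0 /andP[s0 sn]; apply/negP => /eqP H0.
have [w0 t0 w0U] := box_in_open r0 oU U0.
pose s' := (s + n%:R) / 2.
have ss' : s < s' by rewrite /s'; lra.
have s'n : s' < n%:R by rewrite /s'; lra.
have s'0 : 0 < s' by exact: le_lt_trans ss'.
have [|e e0 nocover] := winning_not_covered (s := s') r0 r_sum a0 win t0.
  by rewrite s'0 s'n.
have e20 : 0 < e / 2 by rewrite divr_gt0.
have : (hausdorff_premeasure s 1 (S `&` U) < (e / 2)%:E)%E.
  apply: (@le_lt_trans _ _ 0%E); last by rewrite lte_fin.
  by rewrite -H0; apply: ereal_sup_ubound; exists 1 => //; exact: ltr01.
move=> /ereal_inf_lt[_ [C [cover small] <-] sumC].
have wge0 k : (0 <= hausdorff_weight s (C k))%E by exact: hausdorff_weight_ge0.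
have wfin k : hausdorff_weight s (C k) \is a fin_num.
  rewrite ge0_fin_numE//; apply: le_lt_trans (lt_trans sumC (ltry _)).
  exact: (@nneseries_ge_term _ (fun k => hausdorff_weight s (C k))).
pose x k := fine (hausdorff_weight s (C k)) + e / 2 / (2 ^ k.+1)%:R.
have x0 k : 0 < x k by rewrite ltr_wpDl ?fine_ge0// divr_gt0// ltr0n expn_gt0.
have xK k : (x k `^ s'^-1) `^ s' = x k.
  by rewrite -powRrM mulVf ?gt_eqF// powRr1// ltW.
have [||v [Sv w0v far]] := nocover (fun k => xget 0 (C k)) (fun k => x k `^ s'^-1).
- by move=> k; rewrite powR_gt0.
- under eq_eseriesr do rewrite xK /x EFinD fineK//.
  apply: le_trans (epsilon_trick _ _ (ltW e20)) _ => //.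
  by rewrite [leRHS](_ : _ = (e / 2)%:E + (e / 2)%:E)%E ?leeD2r ?ltW// -EFinD -splitr.
have [k _ Ckv] := cover v (conj Sv (w0U _ w0v)).
have [j] := far k; apply/negP; rewrite -leNgt.
have Cku : C k (xget 0 (C k)) by apply: xgetPex; exists v.
have := coord_le_norm (v - xget 0 (C k)) j; rewrite !mxE => /le_trans; apply.
have := diameter_le_weight (s := s) (s' := s') _ s'0 (small k) Ckv Cku.
rewrite s0 ltW// => /(_ isT) le.
rewrite -[leLHS]powRr1// -[X in _ `^ X](@divff _ s') ?gt_eqF// powRrM.
rewrite ge0_ler_powR ?nnegrE ?powR_ge0 ?invr_ge0 ?(ltW s'0) ?(ltW (x0 k))//.
by apply: le_trans le _; rewrite lerDl ltW// divr_gt0// ltr0n expn_gt0.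
Qed.

Lemma winning_thick (R : realType) (n : nat) (r : 'I_n -> R) (a : R)
    (S : set 'cV[R]_n) :
  (forall i, 0 < r i) -> \sum_(i < n) r i = 1 -> 0 < a ->
  a_winning (psi_box r) a S -> thick S.
Proof.
move=> r0 r_sum a0 win U oU U0; apply/eqP; rewrite eq_le; apply/andP; split.
  apply/lee_addgt0Pr => e e0; apply: ereal_inf_lbound.
  exists (n%:R + e) => //; split; first by rewrite addr_ge0// ltW.
  by apply: hausdorff_measure_gt_dim; rewrite ltrDl.
apply: le_ereal_inf_tmp => _ [s [s0 Hs] <-]; rewrite lee_fin leNgt.
apply/negP => sn; have := winning_hausdorff_measure (s := s) r0 r_sum a0 win oU U0.
by rewrite s0 sn Hs eqxx => /(_ isT).
Qed.

(** * Intersections of affine images of Bad *)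

Theorem mainTheorem4 (R : realType) (n : nat) (hn : (1 <= n)%N)
    (r : 'I_n -> R) (r_gt0 : forall i, 0 < r i)
    (r_sum : \sum_(i < n) r i = 1)
    (a : R) (ha : \big[Num.max/0]_(i < n) (ln 2 / (1 + r i)) < a)
    (L : nat -> 'M[R]_n)
    (L_diag : forall i, is_diag_mx (L i))
    (L_unit : forall i, L i \in unitmx)
    (y : nat -> 'cV[R]_n) :
  a_winning (psi_box r) a
    (\bigcap_i [set L i *m x + y i | x in Bad r]) /\
  thick (\bigcap_i [set L i *m x + y i | x in Bad r]).
Proof.
have [a0 ra] : 0 < a /\ forall i, ln 2 / (1 + r i) < a.
  by move: ha => /bigmax_ltP[a0 ra]; split=> // i; exact: ra.
have sa i : side r i a < 1 / 2.
  have ri : 0 < 1 + r i by rewrite addr_gt0.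
  rewrite div1r -[ltRHS]lnK ?posrE ?invr_gt0// lnV ?posrE// ltr_expR.
  by rewrite mulNr ltrN2 mulrC -ltr_pdivrMr.
have win := Bad_winning y r_gt0 r_sum a0 sa L_diag L_unit.
by split; [exact: win|exact: winning_thick win].
Qed.
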